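(* Consider the ''deter'' phase of the cartel as described in the context. If $2k^f-k^c\le\alpha$, then for a.e. $t$ in this phase the optimal control is $q^c(t)=\frac{\alpha-k^f}{\beta}$, the price is $k^f$, and the cartel's depletion time is $\tilde T^c=\frac{S_0^c\,\beta}{\alpha-k^f}$.
   Context: Constants: $\alpha,\beta,r>0$, $k^c<k^f<b<\alpha$, and the cartel's initial stock $S_0^c>0$. In this phase, starting at time $0$, the cartel extracts as the sole extractor at a price $p(t)=\alpha-\beta q^c(t)\in[0,k^f]$ (so that the fringe's extraction is $Q^f(t)=0$); that is, its measurable control satisfies $q^c(t)\in\left[\frac{\alpha-k^f}{\beta},\frac{\alpha}{\beta}\right]$. The stock satisfies $\dot S^c(t)=-q^c(t)$, $S^c(0)=S_0^c$, and the phase ends at the (free) depletion time $T^c$, the first time with $S^c(T^c)=0$. The cartel maximizes $\int_0^{T^c}e^{-rt}(\alpha-\beta q^c(t)-k^c)q^c(t)\,dt$. *)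

(* Defs.v *)
From HB Require Import structures.
From mathcomp Require Import all_boot all_order all_algebra.
From mathcomp Require Import all_classical all_reals all_analysis.

Set Implicit Arguments.
Unset Strict Implicit.
Unset Printing Implicit Defensive.

Import Order.TTheory GRing.Theory Num.Theory.
Import numFieldNormedType.Exports.

Local Open Scope classical_set_scope.
Local Open Scope ring_scope.

Section DeterPhase.
Context {R : realType}.
Notation mu := (@lebesgue_measure R).

(* Price when the cartel is the sole extractor (the fringe extracts 0). *)
Definition price (alpha beta x : R) : R := alpha - beta * x.

(* The solution of S' = - q, S(0) = S0: since the control q is only
   measurable, the equation is understood in the Caratheodory sense, i.e. as
   an integral equation. *)
Definition stock (S0 : R) (q : R -> R) (t : R) : R :=
  S0 - (\int[mu]_(s in `[0, t]) q s)%R.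

Definition depletion_time (S0 : R) (q : R -> R) (T : R) : Prop :=
  [/\ 0 <= T, stock S0 q T = 0 &
      forall t, 0 <= t < T -> stock S0 q t <> 0].

(* The terminal time is free, so the decision is a pair (q, T), where T is the
   depletion time of q; only the values of q on [0, T] matter. *)
Definition admissible (alpha beta kf S0 : R) (q : R -> R) (T : R) : Prop :=
  [/\ measurable_fun `[0, T] q,
      forall t, t \in `[0, T] -> (alpha - kf) / beta <= q t <= alpha / beta &
      depletion_time S0 q T].

Definition payoff (alpha beta r kc : R) (q : R -> R) (T : R) : R :=
  (\int[mu]_(t in `[0, T])
     (expR (- (r * t)) * (price alpha beta (q t) - kc) * q t))%R.

Definition optimal (alpha beta r kc kf S0 : R) (q : R -> R) (T : R) : Prop :=
  admissible alpha beta kf S0 q T /\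
  forall (q' : R -> R) (T' : R), admissible alpha beta kf S0 q' T' ->
    payoff alpha beta r kc q' T' <= payoff alpha beta r kc q T.

End DeterPhase.

(* Main.v *)
Require Import Defs.
From HB Require Import structures.
From mathcomp Require Import all_boot all_order all_algebra.
From mathcomp Require Import all_classical all_reals all_analysis.
From mathcomp Require Import measurable_realfun ring lra.
Import Order.TTheory GRing.Theory Num.Theory.
Import numFieldNormedType.Exports.
Local Open Scope classical_set_scope.
Local Open Scope ring_scope.

(** The current revenue [x |-> (alpha - beta x - kc) x] of the cartel is
concave, and the hypothesis [2 kf - kc <= alpha] says that its derivative at
[m = (alpha - kf) / beta] is nonpositive.  The admissible rates are at least
[m], so [m] maximizes the revenue among them at every single instant.  Being
the smallest of them, it is also the rate that exhausts the stock last: an admissible [(q, T)] satisfies [m T <= S0], that is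
[T <= T~] with [T~ = S0 / m] ([depletion_time_le]).  So, [J (q, T)] denoting
the payoff,
  [J (q, T) <= J (m, T) <= J (m, T~)],
where the first inequality is pointwise ([payoff_le_lowest_rate]) and the
second holds because the revenue [(kf - kc) m] is positive, strictly if
[T < T~] ([payoff_lowest_rate_lt]).  There is thus no trade-off between
current revenue and duration of the phase.

For uniqueness, an optimal [(q, T)] makes the second inequality an equality,
so [T = T~].  Then [q >= m] on [[0, T]] while the integral of [q] there is
[S0 = m T], which forces [q = m] almost everywhere ([ae_eq_lower_bound]). *)

(** * Integrals over compact intervals *)

Lemma bounded_itv_integrable {R : realType} (a b lo hi : R) (f : R -> R) :
  measurable_fun `[a, b] f -> (forall t, t \in `[a, b] -> lo <= f t <= hi) ->
  (@lebesgue_measure R).-integrable `[a, b] (EFin \o f).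
Proof.
move=> mf fb; apply: measurable_bounded_integrable => //.
  rewrite [X in (X < _)%E](lebesgue_measure_itv `[a, b])/=.
  by case: ifP => // _; rewrite -EFinB ltry.
exists (`|lo| + `|hi|); split; first exact: num_real.
move=> M ltM t abt; apply: ltW; apply: le_lt_trans ltM => /=.
have /andP[lof fhi] := fb t abt.
rewrite ler_norml; apply/andP; split.
  rewrite (le_trans _ lof)// opprD lerBlDr.
  by rewrite (@le_trans _ _ lo) ?lerDl// lerNl -normrN ler_norm.
by rewrite (le_trans fhi)// (le_trans (ler_norm _))// lerDr.
Qed.

Lemma integrable_cst_itv {R : realType} (a b c : R) :
  (@lebesgue_measure R).-integrable `[a, b] (EFin \o cst c).
Proof. by apply: (@bounded_itv_integrable _ _ _ c c) => // t _; rewrite lexx. Qed.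

Lemma Rintegral_cst_itv {R : realType} (c T : R) : 0 <= T ->
  \int[@lebesgue_measure R]_(t in `[0, T]) c = c * T.
Proof.
move=> T0; rewrite Rintegral_cst//.
rewrite [X in fine X](lebesgue_measure_itv `[0, T])/= lte_fin.
case: ltP => [_|T0']; first by rewrite -EFinB subr0.
by rewrite (_ : T = 0) //; apply/eqP; rewrite eq_le T0 T0'.
Qed.

(** The additional interval contributes at least [c (T - S)]. *)
Lemma Rintegral_itv_lt {R : realType} (c S T : R) (f : R -> R) :
  0 < c -> 0 <= S < T ->
  (@lebesgue_measure R).-integrable `[0, T] (EFin \o f) ->
  (forall t, t \in `[0, T] -> c <= f t) ->
  \int[@lebesgue_measure R]_(t in `[0, S]) f t <
  \int[@lebesgue_measure R]_(t in `[0, T]) f t.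
Proof.
move=> c0 /andP[S0 ST] fi cf; rewrite -subr_gt0 Rintegral_itvB//; last first.
  by rewrite bnd_simp ltW.
have sub : `]S, T] `<=` `[0, T].
  by move=> t /=; rewrite !in_itv/= => /andP[St ->]; rewrite (le_trans S0)// ltW.
have subi g : (@lebesgue_measure R).-integrable `[0, T] g ->
    (@lebesgue_measure R).-integrable `]S, T] g.
  by apply: integrableS.
apply: (@lt_le_trans _ _ (\int[@lebesgue_measure R]_(t in `]S, T]) (cst c t))).
  rewrite Rintegral_cst// [X in fine X](lebesgue_measure_itv `]S, T])/= lte_fin ST.
  by rewrite -EFinB mulr_gt0// subr_gt0.
apply: le_Rintegral => //; [exact/subi/integrable_cst_itv|exact: subi|].
by move=> t /sub; exact: cf.
Qed.

(** The nonnegative function [f - c] has integral zero. *)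
Lemma ae_eq_lower_bound {R : realType} (c T : R) (f : R -> R) : 0 <= T ->
  (@lebesgue_measure R).-integrable `[0, T] (EFin \o f) ->
  (forall t, t \in `[0, T] -> c <= f t) ->
  \int[@lebesgue_measure R]_(t in `[0, T]) f t = c * T ->
  {ae (@lebesgue_measure R), forall t, t \in `[0, T] -> f t = c}.
Proof.
move=> T0 fi fb intf.
have ci := integrable_cst_itv 0 T c.
pose g : R -> R := f \- cst c.
have gi : (@lebesgue_measure R).-integrable `[0, T] (EFin \o g).
  rewrite [X in integrable _ _ X](_ : _ = (EFin \o f) \- (EFin \o cst c))%E //.
  exact: integrableB.
have int0 : (\int[@lebesgue_measure R]_(t in `[0%R, T])
    `|(EFin \o g) t| = 0)%E.
  transitivity (\int[@lebesgue_measure R]_(t in `[0%R, T]) (g t)%:E)%E.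
    apply: eq_integral.
    move=> t; rewrite inE/= => Tt.
    by rewrite ger0_norm// subr_ge0; apply: fb.
  rewrite -[LHS]fineK; last exact: integrable_fin_num.
  congr EFin.
  rewrite -[LHS]/(\int[@lebesgue_measure R]_(t in `[0, T]) (f t - cst c t)).
  by rewrite RintegralB// intf Rintegral_cst_itv// subrr.
have/integrableP[mg _] := gi.
have [/(_ int0)] := ae_eq_integral_abs (@lebesgue_measure R) (measurable_itv _) mg.
move=> H _; apply: filterS H => t tH Tt.
by have [/eqP] := tH Tt; rewrite subr_eq0 => /eqP.
Qed.

(** * The deter phase *)

Lemma measurable_discount {R : realType} (r : R) (D : set R) :
  measurable_fun D (fun t : R => expR (- (r * t))).
Proof.
by do 2 apply: measurableT_comp => //.
Qed.

(** The left side minus the right side is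
[(x - m) (kf - kc - beta x)] with [m = (alpha - kf) / beta]; its first factor
is nonnegative and its second one is at most [kf - kc - beta m], which is
[2 kf - kc - alpha <= 0]. *)
Lemma revenue_le_lowest_rate {R : realType} {alpha beta kc kf x : R} :
  0 < beta -> 2 * kf - kc <= alpha -> (alpha - kf) / beta <= x ->
  (price alpha beta x - kc) * x <=
  (price alpha beta ((alpha - kf) / beta) - kc) * ((alpha - kf) / beta).
Proof.
move=> beta0 hdeter; set m := (alpha - kf) / beta => mx.
have mE : beta * m = alpha - kf by rewrite mulrC divfK// gt_eqF.
have bmx : beta * m <= beta * x by rewrite ler_pM2l.
rewrite -subr_ge0 /price.
have -> : (alpha - beta * m - kc) * m - (alpha - beta * x - kc) * x =
  (x - m) * (beta * x + beta * m - (alpha - kc)) by ring.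
by apply: mulr_ge0; lra.
Qed.

Lemma price_lowest_rate {R : realType} {alpha beta kf : R} : beta != 0 ->
  price alpha beta ((alpha - kf) / beta) = kf.
Proof. by move=> beta0; rewrite /price mulrC divfK// opprB addrC subrK. Qed.

Lemma admissible_integrable {R : realType} {alpha beta kf S0 : R} {q T} :
  admissible alpha beta kf S0 q T ->
  (@lebesgue_measure R).-integrable `[0, T] (EFin \o q).
Proof. by move=> [mq qb _]; exact: bounded_itv_integrable mq qb. Qed.

Lemma depletion_time_le {R : realType} {alpha beta kf S0 : R} {q T} :
  0 < beta -> kf < alpha -> admissible alpha beta kf S0 q T ->
  T <= S0 * beta / (alpha - kf).
Proof.
move=> beta0 kfa adm; have [_ qb [T0 /eqP + _]] := adm.
rewrite /stock subr_eq0 => /eqP S0E.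
have ak0 : 0 < alpha - kf by rewrite subr_gt0.
rewrite ler_pdivlMr// -ler_pdivrMr// -mulrA mulrC S0E -Rintegral_cst_itv//.
apply: le_Rintegral => //; first exact: integrable_cst_itv.
  exact: admissible_integrable adm.
by move=> t /qb/andP[].
Qed.

Lemma admissible_lowest_rate {R : realType} {alpha beta kf S0 : R} :
  0 < beta -> 0 <= kf < alpha -> 0 < S0 ->
  admissible alpha beta kf S0 (fun=> (alpha - kf) / beta)
    (S0 * beta / (alpha - kf)).
Proof.
move=> beta0 /andP[kf0 kfa] S00.
have ak0 : 0 < alpha - kf by rewrite subr_gt0.
have T0 : 0 < S0 * beta / (alpha - kf) by rewrite divr_gt0// mulr_gt0.
have stockE t : 0 <= t ->
    stock S0 (fun=> (alpha - kf) / beta) t = S0 - (alpha - kf) / beta * t.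
  by move=> t0; rewrite /stock Rintegral_cst_itv.
split=> //.
- by move=> t _; rewrite lexx/= ler_pM2r ?invr_gt0// lerBlDr lerDl.
- split; first exact: ltW.
    by rewrite stockE ?ltW//; field; rewrite !gt_eqF.
  move=> t /andP[t0 tT]; rewrite stockE//; apply/eqP; rewrite gt_eqF// subr_gt0.
  by rewrite mulrAC ltr_pdivrMr// mulrC -ltr_pdivlMr.
Qed.

(** The integrand is bounded: the discount factor lies in [[0, 1]] and the
revenue is at most its value at the lowest rate.  From below, the price is
nonnegative and [q <= alpha / beta], so the revenue is at least
[- |kc| alpha / beta], a bound that also covers a negative margin. *)
Lemma payoff_integrable {R : realType} {alpha beta r kc kf T : R} {q : R -> R} :
  0 < beta -> 0 < r -> kc < kf -> kf < alpha -> 2 * kf - kc <= alpha ->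
  measurable_fun `[0, T] q ->
  (forall t, t \in `[0, T] -> (alpha - kf) / beta <= q t <= alpha / beta) ->
  (@lebesgue_measure R).-integrable `[0, T] (EFin \o
    (fun t => expR (- (r * t)) * (price alpha beta (q t) - kc) * q t)).
Proof.
move=> beta0 r0 kckf kfa hdeter mq qb.
set m := (alpha - kf) / beta.
have ak0 : 0 < alpha - kf by rewrite subr_gt0.
have m0 : 0 < m by rewrite divr_gt0.
apply: (@bounded_itv_integrable _ _ _ (- (`|kc| * (alpha / beta)))
  ((price alpha beta m - kc) * m)).
  apply: measurable_funM => //; apply: measurable_funM.
    exact: measurable_discount.
  apply: measurable_funB => //; apply: measurable_funB => //.
  exact: measurable_funM.
move=> t Tt; have /andP[mqt qta] := qb t Tt.
have t0 : 0 <= t by move: Tt; rewrite in_itv/= => /andP[].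
have e0 : 0 <= expR (- (r * t)) by exact: expR_ge0.
have e1 : expR (- (r * t)) <= 1.
  by rewrite -expR0 ler_expR oppr_le0 mulr_ge0// ltW.
have q0 : 0 <= q t by rewrite (le_trans (ltW m0)).
have p0 : 0 <= price alpha beta (q t).
  by rewrite /price subr_ge0 mulrC -ler_pdivlMr.
have rev_le := revenue_le_lowest_rate beta0 hdeter mqt.
have rev_ge : - (`|kc| * (alpha / beta)) <= (price alpha beta (q t) - kc) * q t.
  apply: (@le_trans _ _ (- (`|kc| * q t))).
    by rewrite lerN2 ler_wpM2l.
  by rewrite -mulNr ler_wpM2r// (le_trans (_ : _ <= - kc)) ?lerN2 ?ler_norm// lerDr.
have revm0 : 0 <= (price alpha beta m - kc) * m.
  by rewrite price_lowest_rate ?gt_eqF// mulr_ge0 ?subr_ge0// ltW.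
have lo0 : 0 <= `|kc| * (alpha / beta).
  by rewrite mulr_ge0// (le_trans q0).
rewrite -mulrA; apply/andP; split; first by nra.
by rewrite -/m in rev_le; nra.
Qed.

Lemma payoff_lowest_rate_integrable {R : realType} {alpha beta r kc kf T : R} :
  0 < beta -> 0 < r -> kc < kf -> 0 <= kf < alpha -> 2 * kf - kc <= alpha ->
  (@lebesgue_measure R).-integrable `[0, T] (EFin \o
    (fun t => expR (- (r * t)) * (price alpha beta ((alpha - kf) / beta) - kc)
              * ((alpha - kf) / beta))).
Proof.
move=> beta0 r0 kckf /andP[kf0 kfa] hdeter.
apply: (payoff_integrable (kf := kf) (q := fun=> (alpha - kf) / beta)) => //.
by move=> t _; rewrite lexx/= ler_pM2r ?invr_gt0// lerBlDr lerDl.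
Qed.

Lemma payoff_le_lowest_rate {R : realType} {alpha beta r kc kf S0 : R} {q T} :
  0 < beta -> 0 < r -> kc < kf -> 0 <= kf < alpha -> 2 * kf - kc <= alpha ->
  admissible alpha beta kf S0 q T ->
  payoff alpha beta r kc q T <=
  payoff alpha beta r kc (fun=> (alpha - kf) / beta) T.
Proof.
move=> beta0 r0 kckf kfb hdeter [mq qb _]; have /andP[_ kfa] := kfb.
apply: le_Rintegral => //.
- exact: payoff_integrable qb.
- exact: payoff_lowest_rate_integrable.
move=> t /qb/andP[mqt _].
by rewrite -!mulrA ler_wpM2l ?expR_ge0//; exact: revenue_le_lowest_rate.
Qed.

(** The integrand is positive, and on [[0, T]] it is at least its value at [T]
because the discount factor decreases. *)
Lemma payoff_lowest_rate_lt {R : realType} {alpha beta r kc kf S T : R} :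
  0 < beta -> 0 < r -> kc < kf -> 0 <= kf < alpha -> 2 * kf - kc <= alpha ->
  0 <= S < T ->
  payoff alpha beta r kc (fun=> (alpha - kf) / beta) S <
  payoff alpha beta r kc (fun=> (alpha - kf) / beta) T.
Proof.
move=> beta0 r0 kckf kfb hdeter ST; have /andP[_ kfa] := kfb.
have pi0 : 0 < (kf - kc) * ((alpha - kf) / beta).
  by rewrite mulr_gt0 ?divr_gt0 ?subr_gt0.
apply: (@Rintegral_itv_lt _
  (expR (- (r * T)) * ((kf - kc) * ((alpha - kf) / beta)))) => //.
- by rewrite mulr_gt0// expR_gt0.
- exact: payoff_lowest_rate_integrable.
move=> t; rewrite in_itv/= => /andP[_ tT].
rewrite price_lowest_rate ?gt_eqF// -[leRHS]mulrA ler_pM2r//.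
by rewrite ler_expR lerN2 ler_pM2l.
Qed.

Theorem proposition4 (R : realType) (alpha beta r kc kf b S0 : R)
  (halpha : 0 < alpha) (hbeta : 0 < beta) (hr : 0 < r)
  (hkc : kc < kf) (hkf : kf < b) (hb : b < alpha)
  (hkf0 : 0 <= kf) (* the price range [0, kf] is nonempty *)
  (hS0 : 0 < S0)
  (hdeter : 2 * kf - kc <= alpha) :
  optimal alpha beta r kc kf S0
    (fun _ : R => (alpha - kf) / beta) (S0 * beta / (alpha - kf)) /\
  forall (q : R -> R) (T : R), optimal alpha beta r kc kf S0 q T ->
    [/\ {ae (@lebesgue_measure R), forall t : R, t \in `[0, T] ->
           q t = (alpha - kf) / beta},
        {ae (@lebesgue_measure R), forall t : R, t \in `[0, T] ->
           price alpha beta (q t) = kf} &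
        T = S0 * beta / (alpha - kf)].
Proof.
have kfa : kf < alpha := lt_trans hkf hb.
have kfb : 0 <= kf < alpha by rewrite hkf0.
have adm0 := admissible_lowest_rate hbeta kfb hS0.
set m := (alpha - kf) / beta; set Tt := S0 * beta / (alpha - kf).
split.
  split=> // q T adm.
  apply: le_trans (payoff_le_lowest_rate hbeta hr hkc kfb hdeter adm) _.
  have [_ _ [T0 _ _]] := adm.
  have := depletion_time_le hbeta kfa adm; rewrite le_eqVlt => /orP[/eqP->//|TT].
  by apply/ltW/payoff_lowest_rate_lt => //; rewrite T0.
move=> q T [adm opt]; have [_ qb [T0 stock0 _]] := adm.
have TE : T = Tt.
  have := depletion_time_le hbeta kfa adm; rewrite le_eqVlt => /orP[/eqP//|TT].
  have lt_payoff : payoff alpha beta r kc q T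
      < payoff alpha beta r kc (fun=> m) Tt.
    apply: le_lt_trans (payoff_le_lowest_rate hbeta hr hkc kfb hdeter adm) _.
    by apply: payoff_lowest_rate_lt => //; rewrite T0.
  by have := lt_le_trans lt_payoff (opt _ _ adm0); rewrite ltxx.
have qE : {ae (@lebesgue_measure R), forall t, t \in `[0, T] -> q t = m}.
  apply: ae_eq_lower_bound => //.
  - exact: admissible_integrable adm.
  - by move=> t /qb/andP[].
  have -> : m * T = S0.
    by rewrite TE /m /Tt; field; rewrite !gt_eqF ?subr_gt0.
  by move: stock0 => /eqP; rewrite /stock subr_eq0 => /eqP.
split=> //; apply: (@filterS _ _ (ae_filter_ringOfSetsType _)) qE => t qt Ht.
by rewrite qt// price_lowest_rate ?gt_eqF.
Qed.
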